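(* Let $G$ be a finite group, let $p$ be a fixed prime in $\pi(G)$, and let $P$ be a Sylow $p$-subgroup of $G$. Let $d_p$ be the smallest generator number of $P$, i.e. $p^{d_p} = |P/\Phi(P)|$, and let $\mathcal{M}_{d_p}(P)=\{P_1,\dots,P_{d_p}\}$ be a set of $d_p$ maximal subgroups of $P$ such that $\bigcap_{i=1}^{d_p} P_i=\Phi(P)$. Suppose that every member of $\mathcal{M}_{d_p}(P)$ is s-semipermutable in $G$. Then either $P$ is of order $p$ or $G$ is $p$-supersoluble.
   Context: All groups are finite. $\pi(G)$ denotes the set of all primes dividing $|G|$, and $\Phi(P)$ denotes the Frattini subgroup of $P$. Two subgroups $H$ and $K$ of $G$ are said to be permutable (or $H$ permutes with $K$) if $HK=KH$. A subgroup $H$ of $G$ is s-semipermutable in $G$ if, for every prime $q \in \pi(G)$ with $(q,|H|)=1$, $H$ permutes with every Sylow $q$-subgroup $G_q$ of $G$, i.e. $HG_q=G_qH$. A group is $p$-supersoluble if each of its chief factors is either of order $p$ or of order prime to $p$. *)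

(* Defs.v *)
From mathcomp Require Import all_boot all_fingroup all_solvable.

Set Implicit Arguments.
Unset Strict Implicit.
Unset Printing Implicit Defensive.

Import GroupScope.

Section Definitions.

Variable gT : finGroupType.
Implicit Types (G H P Q U V : {group gT}).

Definition s_semipermutable G H : Prop :=
  H \subset G /\
  forall (q : nat) Q,
    q \in \pi(G) -> coprime q #|H| -> q.-Sylow(G) Q -> H * Q = Q * H.

Definition p_supersoluble (p : nat) G : Prop :=
  forall V U, chief_factor G V U -> #|U / V| = p \/ coprime #|U / V| p.

End Definitions.

(* The library's generator rank 'm(P) is the exponent d in p ^ d = |P / Phi(P)|
   (Burnside's basis theorem). *)
Lemma card_quotient_Phi (gT : finGroupType) (p : nat) (P : {group gT}) :
  p.-group P -> (p ^ 'm(P))%N = #|P / 'Phi(P)|.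
Proof.
move=> pP; have nPhi := normal_norm (Phi_normal P).
have abP := Phi_quotient_abelem pP.
have abelP := abelem_abelian abP.
have pQ := abelem_pgroup abP.
have -> : 'm(P) = 'm(P / 'Phi(P)).
  apply/eqP; rewrite eqn_leq quotient_grank // andbT.
  have [B genB <-] := grank_witness (P / 'Phi(P)).
  have sBQ : B \subset P / 'Phi(P) by rewrite -genB subset_gen.
  pose C : {set gT} := [set repr (set_of_coset x) | x : coset_of _ in B].
  have reprP (x : coset_of _) : x \in B -> repr (set_of_coset x) \in P.
    move=> Bx; have := subsetP sBQ x Bx; rewrite -{1}(coset_reprK x) => Qx.
    suff: repr (set_of_coset x) \in coset 'Phi(P) @*^-1 (P / 'Phi(P)).
      by rewrite quotientGK ?Phi_normal.
    by rewrite mem_morphpre ?repr_coset_norm.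
  have sCP : C \subset P by apply/subsetP=> _ /imsetP[x Bx ->]; exact: reprP.
  have imC : C / 'Phi(P) = B.
    rewrite quotientE morphimEsub ?(subset_trans sCP) // -imset_comp.
    rewrite -[RHS]imset_id; apply: eq_imset => x; exact: coset_reprK.
  have genC : <<C>> = P.
    have sgCP : <<C>> \subset P by rewrite gen_subG.
    apply: Phi_nongen; apply/eqP; rewrite eqEsubset join_subG Phi_sub sCP /=.
    rewrite -joing_idr norm_joinEr ?(subset_trans sgCP) // -quotientSK //.
    by rewrite quotient_gen ?(subset_trans sCP) // imC genB.
  have := leq_trans (grank_min C) (leq_imset_card _ _).
  by rewrite genC.
rewrite (grank_abelian abelP) (rank_pgroup pQ) (p_rank_abelem abP).
by rewrite -p_part part_pnat_id.
Qed.

(* Main.v *)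
Require Import Defs.
From mathcomp Require Import all_boot all_order all_fingroup all_algebra.
From mathcomp Require Import all_solvable all_field all_character.

(** Put K := 'O_p^'(G). If K * P <| G and #|P| != p, the permuting maximal
    subgroups M of P satisfy M * K <| G, so G acts on P K / K modulo its Frattini
    subgroup as an abelian group of exponent dividing p - 1; hence G / (P * K) is
    such a group, and by Schur's lemma every chief factor of order divisible by p
    is one-dimensional.

    That K * P <| G goes by induction on #|G|, with K = 1 and R := 'O_p(G). The
    subgroups R :&: M are normal in G, hence so is N := R :&: 'Phi(P). If N != 1,
    the conclusion lifts from G / N by a Frattini argument (or P is cyclic, and
    the transfer applies). If N = 1 then P centralises R. For a Sylow q-subgroup Q,
    Kegel's argument puts each M in a {p, q}-group normalised by the normal closure
    of Q; this group is solvable by Burnside's p^a q^b theorem, so that [M, Q]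
    lies in 'F(G) = R. Therefore M * R <| G, every M lies in R, and R = P unless
    #|P| = p. *)

Set Implicit Arguments.
Unset Strict Implicit.
Unset Printing Implicit Defensive.

Import GRing.Theory FinRing.Theory FiniteModule GroupScope.

(** * Permuting subgroups *)

Section Permuting.

Variable gT : finGroupType.
Implicit Types (A B G H X Q : {group gT}).

(** The right translations fixing the set [J * B] form a group. It contains [A1] because
    [J * B * A1 = J * A1 * B = J * B], likewise [A2], and so their join. *)
Lemma commute_joing (A1 A2 B : {group gT}) :
  commute (A1 : {set gT}) B -> commute (A2 : {set gT}) B ->
  commute (A1 <*> A2 : {set gT}) B.
Proof.
pose J := A1 <*> A2; move=> cA1B cA2B.
have stabJB A : A \subset J -> commute (A : {set gT}) B ->
    A \subset 'C[J * B : {set gT} | 'Rs].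
  move=> sAJ cAB; apply/subsetP=> a Aa; apply/astab1P => /=; apply/eqP.
  rewrite rcosetE eqEcard card_rcoset leqnn andbT.
  rewrite -mulgA (subset_trans (mulgS _ (mulgS _ (_ : [set a] \subset A)))) ?sub1set //.
  by rewrite -cAB mulgA mulGSid.
have sJ : J \subset 'C[J * B : {set gT} | 'Rs].
  by rewrite join_subG !stabJB ?joing_subl ?joing_subr.
have sBJ : B * J \subset J * B.
  apply/subsetP=> _ /mulsgP[b y Bb Jy ->].
  have /astab1P/= <- := subsetP sJ y Jy.
  by rewrite rcosetE mem_rcoset mulgK -[b]mul1g mem_mulg.
(* [B * J] is the set of inverses of [J * B], so both have the same size. *)
apply/eqP; rewrite eq_sym eqEcard sBJ -[(J * B)]invgK /= invMG.
by rewrite card_invg leqnn.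
Qed.

Lemma commuteJ (A B : {set gT}) x : commute A B -> commute (A :^ x) (B :^ x).
Proof. by rewrite /commute -!conjsMg => ->. Qed.

(* Kegel's argument: choose A >= X maximal among the pi-groups permuting with
   all conjugates of Q. For x in Q :^ g, the join of A and A :^ x lies in the
   pi-group A * Q :^ g, hence equals A. *)
Lemma normal_closure_permuting (pi : nat_pred) G X Q :
    X \subset G -> Q \subset G -> pi.-group X -> pi.-group Q ->
    (forall g, g \in G -> commute (X : {set gT}) (Q :^ g)) ->
  exists A : {group gT},
    [/\ X \subset A, A \subset G, pi.-group A & <<class_support Q G>> \subset 'N(A)].
Proof.
move=> sXG sQG piX piQ cXQ.
pose gP A := [&& A \subset G, pi.-group A
  & [forall g in G, A * (Q :^ g) == (Q :^ g) * A]].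
have gPX : gP X.
  by rewrite /gP sXG piX; apply/forall_inP=> g /cXQ/eqP.
have [A /maxgroupP[/and3P[sAG piA /forall_inP cAQ] maxA] sXA] := maxgroup_exists gPX.
exists A; split=> //; rewrite gen_subG class_supportEr.
apply/bigcupsP=> g Gg; apply/subsetP=> x Qx.
have Gx : x \in G by apply: subsetP Qx; rewrite -(conjGid Gg) conjSg.
have cAQg : commute (A : {set gT}) (Q :^ g) by apply/eqP/cAQ.
have sJ : A <*> A :^ x \subset A * (Q :^ g).
  rewrite -(comm_joingE cAQg) join_subG joing_subl conj_subG ?joing_subl //.
  exact: subsetP (joing_subr _ _) _ Qx.
suffices gPJ : gP (A <*> A :^ x)%G.
  by rewrite inE -{2}(maxA _ gPJ (joing_subl _ _)) joing_subr.
apply/and3P; split.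
- by rewrite join_subG sAG -(conjGid Gx) conjSg.
- rewrite /= -(comm_joingE cAQg) in sJ; apply: pgroupS sJ _.
  by rewrite /= comm_joingE // pgroupM piA pgroupJ.
apply/forall_inP=> h Gh; apply/eqP; apply: commute_joing; first exact/eqP/cAQ.
have defQh : Q :^ h = (Q :^ (h * x^-1)) :^ x by rewrite -conjsgM mulgKV.
by rewrite /= defQh; apply: commuteJ; apply/eqP/cAQ; rewrite groupM ?groupV.
Qed.

(** By induction the derived subgroup of [L] lies in ['F(G)], which [L] centralises; so it is
    central and [L] is nilpotent. Normality in [N] suffices since ['F(N)] lies in ['F(G)]. *)
Lemma solvable_cent_Fitting (G N L : {group gT}) :
  N <| G -> L <| N -> solvable L -> L \subset 'C('F(G)) -> L \subset 'F(G).
Proof.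
move=> nsNG; have [n leLn] := ubnP #|L|; elim: n L leLn => // n IHn L leLn nsLN solL cLF.
have [-> | ntL] := eqsVneq L 1; first exact: sub1G.
have sL'F : L^`(1) \subset 'F(G).
  apply: (IHn (L^`(1))%G).
  - exact: leq_trans (proper_card (sol_der1_proper solL _ ntL)) _.
  - exact: gFnormal_trans.
  - exact: solvableS (der_sub 1 L) solL.
  - exact: subset_trans (der_sub 1 L) cLF.
have nilL : nilpotent L.
  rewrite -quotient_center_nil abelian_nil //.
  rewrite sub_der1_abelian // subsetI der_sub /=.
  by rewrite centsC (subset_trans cLF) ?centS.
apply: subset_trans (Fitting_max nsLN nilL) _.
by apply: Fitting_max; [exact: gFnormal_trans | exact: Fitting_nil].
Qed.

End Permuting.

(** * Chief factors *)

Section ChiefFactors.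
Variable gT : finGroupType.
Implicit Types (E G H K P : {group gT}) (p : nat).

(** [A] is a root of the product of the [X - x] over all [x] in [F]. By Schur's lemma a nonzero
    [A - x] is invertible, and a product of invertible factors cannot vanish. *)
Lemma mx_irr_centgmx_scalar (F : finFieldType) G n
    (rG : mx_representation F G n.+1) (A : 'M[F]_n.+1) :
    mx_irreducible rG -> centgmx rG A -> (A ^+ #|F| = A)%R ->
  exists x, A = (x%:M)%R.
Proof.
move=> irrG cGA Aq.
have := congr1 (horner_mx A) (finField_genPoly F).
rewrite rmorphB rmorphXn /= horner_mx_X Aq subrr rmorph_prod => prod0.
have [/existsP[x /eqP]|/existsPn nsc] := boolP [exists x : F, (A - x%:M == 0)%R].
  by move/subr0_eq; exists x.
suff: (0 : 'M[F]_n.+1)%R \is a GRing.unit by rewrite unitr0.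
rewrite prod0; apply: rpred_prod => x _.
rewrite rmorphB /= horner_mx_X horner_mx_C.
apply: (mx_Schur irrG) (nsc x); apply/centgmxP => h Gh.
rewrite mulmxBl mulmxBr scalar_mxC; congr (_ - _)%R.
exact: (centgmxP cGA).
Qed.

(** [G] acts on [E] by commuting matrices with [A ^+ p = A], which are scalar by the previous lemma.
    Every line is then invariant, and irreducibility leaves dimension 1. *)
Lemma minnormal_abelem_card p E G :
    p.-abelem E -> minnormal E G ->
    {in G &, forall g h, [~ g, h] \in 'C(E)} ->
    {in G, forall g, g ^+ p.-1 \in 'C(E)} ->
  #|E| = p.
Proof.
move=> abelE minE cEG' cEGp.
have [/andP[ntE nEG] _] := mingroupP minE.
have pE := abelem_pgroup abelE; have [p_pr _ _] := pgroup_pdiv pE ntE.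
rewrite (card_pgroup pE) -(dim_abelemE abelE ntE).
have /= irrG : mx_irreducible (abelem_repr abelE ntE nEG) by exact/abelem_mx_irrP.
have /= kerG := rker_abelem abelE ntE nEG.
move: (abelem_repr abelE ntE nEG) irrG kerG => rG irrG kerG.
have rG1 g : g \in G -> g \in 'C(E) -> rG g = 1%:M%R.
  move=> Gg cEg; have : g \in rker rG by rewrite kerG inE Gg.
  by rewrite inE mul1mx => /andP[_ /eqP].
have rGC g h : g \in G -> h \in G -> rG (g * h) = rG (h * g).
  move=> Gg Gh; have Ggh : [~ g, h] \in G by rewrite groupR.
  rewrite commgC [LHS](repr_mxM _ (groupM Gh Gg) Ggh) -[RHS]mulmx1; congr (_ *m _)%R.
  by apply: rG1 => //; apply: cEG'.
have rGX g : g \in G -> (rG g ^+ p = rG g)%R.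
  move=> Gg; rewrite -[X in (_ ^+ X)%R](prednK (prime_gt0 p_pr)) exprS.
  suff -> : (rG g ^+ p.-1 = 1)%R by rewrite mulr1.
  rewrite -[RHS](rG1 _ (groupX _ Gg) (cEGp g Gg)).
  elim: p.-1 => [|n IHn]; first by rewrite expr0 expg0 repr_mx1.
  by rewrite exprS expgS repr_mxM ?groupX // IHn.
have scal g : g \in G -> exists x, rG g = x%:M%R.
  move=> Gg; apply: (mx_irr_centgmx_scalar irrG).
    by apply/centgmxP=> h Gh; rewrite -!repr_mxM //; apply: rGC.
  exact: etrans (congr1 (fun k => rG g ^+ k)%R (card_Fp p_pr)) (rGX g Gg).
have [_ irr] := (mx_irrP rG).1 irrG.
pose v : 'rV['F_p]_('dim E) := const_mx 1%R.
have v0 : (<<v>> != 0)%MS%R.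
  rewrite (eqmx_eq0 (genmxE _)); apply/eqP=> /rowP/(_ ord0)/eqP.
  by rewrite !mxE oner_eq0.
have/eqP: row_full <<v>>%MS.
  apply: irr v0; rewrite (eqmx_module _ (genmxE _)); apply/mxmoduleP=> g Gg.
  by have [x ->] := scal g Gg; rewrite mul_mx_scalar scalemx_sub.
rewrite genmxE => rk_n; rewrite -[RHS]expn1.
congr (_ ^ _)%N; apply/eqP; by rewrite eqn_leq -{1}rk_n rank_leq_row.

Qed.

(** Transfer into [P] kills the derived subgroup and sends an element of [P] central in [G] to its
    power of exponent [#|G : P|], which is prime to [#|P|]. *)
Lemma abelian_Hall_der1_center_TI G P :
  abelian P -> Hall G P -> P :&: 'Z(G) :&: G^`(1) = 1.
Proof.
move=> abP /andP[sPG coPG].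
have abP' : abelian (idm P @* P) by rewrite im_idm.
pose t := transfer_morphism G abP'.
apply/trivgP/subsetP=> z /setIP[/setIP[Pz /centerP[Gz cGz]] G'z].
have tz0 : t z = 1.
  suff: G^`(1) \subset 'ker t by move/subsetP/(_ z G'z)/mker.
  rewrite gen_subG; apply/subsetP=> _ /imset2P[x y Gx Gy ->].
  apply/kerP; rewrite ?groupR // morphR //.
  by apply/eqP/commgP; apply: zmod_mulgC.
have tz : t z = (fmod abP' z *+ #|G : P|)%R.
  rewrite /= /transfer -GRing.sumr_const; apply: eq_bigr => _ /rcosetsP[x Gx ->].
  have Gr : repr (P :* x) \in G.
    have [y Py] := rcosetP (mem_repr_rcoset P x).
    by move=> ->; rewrite groupM // (subsetP sPG).
  (* Being central and in [P], [z] fixes each coset of [P], so each summand is [z] itself. *)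
  rewrite -rcosetM -(cGz x Gx) rcosetM (rcoset_id Pz).
  by rewrite -(cGz _ Gr) mulgK.
have : z ^+ #|G : P| = 1.
  have Pz' : z \in idm P @* P by rewrite im_idm.
  by rewrite -(fmodK abP' Pz') -fmvalZ -tz tz0.
by move/(canRL_in (expgK coPG) Pz); rewrite expg1n => ->; rewrite inE.
Qed.

Lemma minnormal_setI_eq E G H :
  minnormal E G -> G \subset 'N(H) -> E :&: H != 1 -> E \subset H.
Proof.
case/mingroupP=> /andP[_ nEG] minE nHG ntEH.
rewrite -(minE (E :&: H)%G) ?subsetIl ?subsetIr //.
by rewrite ntEH normsI.
Qed.

(** [E] meets [K] trivially, so [K] centralises [E]; it meets [P], so by minimality it lies in
    [K <*> P] and embeds there modulo [K] as a [p]-group. It then meets ['Z(P)], and by minimality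
    again [K <*> P] centralises [E]. *)
Lemma minnormal_card_prime p G K P E :
    p.-Sylow(G) P -> K <| G -> p^'.-group K -> K <*> P <| G ->
    G^`(1) \subset K <*> P -> {in G, forall g, g ^+ p.-1 \in K <*> P} ->
    prime p -> minnormal E G -> E \subset G -> p %| #|E| ->
  #|E| = p.
Proof.
move=> sylP nsKG p'K nsSG sG'S sGpS p_pr minE sEG pE.
have [/andP[ntE nEG] _] := mingroupP minE.
have nsEG : E <| G by apply/andP.
have [sPG pP _] := and3P sylP; have nKG := normal_norm nsKG.
have nSG := normal_norm nsSG.
have nKP := subset_trans sPG nKG.
have tiEK : E :&: K = 1.
  apply/eqP/negPn/negP=> /(minnormal_setI_eq minE nKG) sEK.
  have := pgroupS sEK p'K; rewrite /pgroup p'natE //.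
  by rewrite pE.
have cEK : K \subset 'C(E).
  rewrite centsC; apply/commG1P/trivgP; rewrite -tiEK subsetI.
  rewrite commg_subl commg_subr (subset_trans sEG nKG) andbT.
  exact: subset_trans (normal_sub nsKG) nEG.
have sylPE := Sylow_setI_normal nsEG sylP.
have sES : E \subset K <*> P.
  apply: (minnormal_setI_eq minE nSG); apply: contraTneq pE => tiES.
  have /pHallP[_ /=] := sylPE; rewrite (_ : E :&: P = 1).
    by rewrite cards1 => /esym/eqP; rewrite p_part_eq1 mem_primes p_pr cardG_gt0.
  by apply/trivgP; rewrite -tiES setIS ?joing_subr.
have pgE : p.-group E.
  rewrite (isog_pgroup _ (quotient_isog (subset_trans sEG nKG) _)) 1?setIC //.
  apply: (pgroupS (quotientS K sES)); rewrite /= quotientYidl //.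
  exact: quotient_pgroup.
have sEP : E \subset P.
  exact: subset_trans (pcore_max pgE nsEG) (pcore_sub_Hall sylP).
have ntEZ : E :&: 'Z(P) != 1.
  apply: meet_center_nil ntE; first exact: pgroup_nil pP.
  exact: normalS sEP sPG nsEG.
have cES : K <*> P \subset 'C(E).
  rewrite centsC; apply: (minnormal_setI_eq minE); first exact: norms_cent.
  apply: subG1_contra ntEZ; rewrite subsetI subsetIl /= centY subsetI.
  rewrite subIset ?[E \subset 'C(K)]centsC ?cEK //=.
  by rewrite /center setIA subsetIr.
apply: (minnormal_abelem_card _ minE).
- have [_ _] := minnormal_solvable minE (subxx _) (pgroup_sol pgE).
  by rewrite (is_abelem_pgroup pgE).
- move=> g h Gg Gh; apply: (subsetP cES); apply: (subsetP sG'S).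
  by rewrite mem_commg.
- by move=> g Gg; apply: (subsetP cES); apply: sGpS.
Qed.

End ChiefFactors.

(** All hypotheses pass to [G / V], where the chief factor is a minimal normal subgroup. *)
Lemma p_supersoluble_criterion (gT : finGroupType) (p : nat) (G K P : {group gT}) :
    p.-Sylow(G) P -> K <| G -> p^'.-group K -> K <*> P <| G ->
    G^`(1) \subset K <*> P -> {in G, forall g, g ^+ p.-1 \in K <*> P} ->
    prime p ->
  p_supersoluble p G.
Proof.
move=> sylP nsKG p'K nsSG sG'S sGpS p_pr V U chfUV.
have minUV := chief_factor_minnormal chfUV.
have [/maxgroupp/andP[_ nVG] nsUG] := andP chfUV.
have sPG := pHall_sub sylP; have sKG := normal_sub nsKG.
have nVP := subset_trans sPG nVG; have nVK := subset_trans sKG nVG.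
have [pU|] := boolP (p %| #|U / V|); last first.
  by rewrite -prime_coprime // coprime_sym; right.
left; have defS : (K / V) <*> (P / V) = (K <*> P) / V by rewrite quotientY.
have := minnormal_card_prime (quotient_pHall nVP sylP) (quotient_normal V nsKG).
rewrite /= !defS; apply=> //.
- exact: quotient_pgroup.
- exact: quotient_normal.
- by rewrite -quotient_der // quotientS.
- move=> _ /morphimP[g Ng Gg ->]; rewrite -morphX //=.
  by rewrite mem_quotient ?sGpS.
exact: quotientS (normal_sub nsUG).
Qed.

(** * Normality of the Sylow subgroup modulo the p'-core *)

Section SylowPermuting.
Variable gT : finGroupType.
Implicit Types (G H P Q M R : {group gT}) (p : nat).

(** [q != p] replaces coprimality to [#|M|], so that the condition does not change with the order of
    [M] in quotients. *)
Definition Sylow_p'_permuting p G M : Prop :=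
  forall q Q, prime q -> q != p -> q.-Sylow(G) Q -> commute (M : {set gT}) Q.

(* The permuting maximal subgroups of P intersect in 'Phi(P): elementwise, since
   they form a Prop-defined family. *)
Definition Phi_from_permuting p G P : Prop :=
  forall x, x \in P ->
    (forall M, maximal M P -> Sylow_p'_permuting p G M -> x \in M) -> x \in 'Phi(P).

Lemma Sylow_norms_sub p G P H :
    p.-Sylow(G) P -> P \subset 'N(H) ->
    (forall q Q, prime q -> q != p -> q.-Sylow(G) Q -> Q \subset 'N(H)) ->
  G \subset 'N(H).
Proof.
move=> sylP nHP nHQ; pose T := [set Q : {group gT} | Q \subset 'N_G(H)].
rewrite -(@Sylow_transversal_gen _ T G).
- by rewrite gen_subG; apply/bigcupsP=> Q; rewrite inE subsetI => /andP[].
- by move=> Q; rewrite inE subsetI => /andP[].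
move=> q; rewrite mem_primes => /and3P[q_pr _ _].
have [-> | q'p] := eqVneq q p.
  by exists P => //; rewrite inE subsetI (pHall_sub sylP).
have [Q sylQ] := Sylow_exists q G; exists Q => //.
by rewrite inE subsetI (pHall_sub sylQ) (nHQ q).
Qed.

(** For a Sylow [q]-subgroup [Q], [M] is a Sylow [p]-subgroup of the group [M <*> Q], so it contains
    the normal [p]-subgroup [R :&: (M <*> Q)], and [Q] normalises [R :&: M]. *)
Lemma normal_setI_permuting p G P M R :
    p.-Sylow(G) P -> M <| P -> Sylow_p'_permuting p G M ->
    R <| G -> p.-group R ->
  R :&: M <| G.
Proof.
move=> sylP nsMP permM nsRG pR.
have [sRG nRG] := andP nsRG; have [sMP nMP] := andP nsMP.
have [sPG pP _] := and3P sylP.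
apply/andP; split; first by rewrite subIset ?sRG.
apply: (Sylow_norms_sub sylP); first by rewrite normsI ?(subset_trans sPG nRG).
move=> q Q q_pr q'p sylQ; have [sQG qQ _] := and3P sylQ.
have cMQ := permM _ _ q_pr q'p sylQ.
have sMQG : M <*> Q \subset G by rewrite join_subG (subset_trans sMP).
have sylM : p.-Sylow(M <*> Q) M.
  rewrite pHallE joing_subl /= comm_joingE //.
  have p'Q : p^'.-nat #|Q| by apply: pi_pnat qQ _; rewrite !inE.
  have coMQ : coprime #|M| #|Q|.
    exact: pnat_coprime (pgroupS sMP pP) p'Q.
  rewrite coprime_cardMg // partnM // (part_pnat_id (pgroupS sMP pP)).
  by rewrite part_p'nat ?muln1.
have defRM : R :&: (M <*> Q) = R :&: M.
  apply/eqP; rewrite eqEsubset andbC setIS ?joing_subl //= subsetI subsetIl /=.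
  apply: subset_trans (pcore_sub_Hall sylM); apply: pcore_max.
    exact: pgroupS (subsetIl _ _) pR.
  by rewrite /= setIC (normalGI sMQG nsRG).
rewrite /= -defRM (subset_trans (joing_subr M Q)) // normsI ?normG //.
exact: subset_trans sMQG nRG.
Qed.

Lemma permuting_sub_pcore p G P M :
    prime p -> p.-Sylow(G) P -> M <| P -> Sylow_p'_permuting p G M ->
    'O_p^'(G) = 1 -> P \subset 'C('O_p(G)) ->
  M \subset 'O_p(G).
Proof.
move=> p_pr sylP nsMP permM p'G1 cPR; set R := 'O_p(G) in cPR *.
have [sMP nMP] := andP nsMP; have [sPG pP _] := and3P sylP.
have nsRG : R <| G := pcore_normal p G; have [sRG nRG] := andP nsRG.
have pR : p.-group R := pcore_pgroup p G.
have defF : 'F(G) = R := Fitting_eq_pcore p'G1.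
have sMG := subset_trans sMP sPG.
suffices nMR : G \subset 'N(M <*> R).
  apply: subset_trans (joing_subl M R) (pcore_max _ _).
    rewrite /= norm_joinEl ?(subset_trans sMG) // pgroupM pR.
    by rewrite (pgroupS sMP pP).
  by apply/andP; rewrite join_subG sMG sRG.
apply: (Sylow_norms_sub sylP); first by rewrite normsY ?(subset_trans sPG nRG).
move=> q Q q_pr q'p sylQ; have [sQG qQ _] := and3P sylQ.
have [] := @normal_closure_permuting _ (pred2 p q) G M Q sMG sQG.
- by apply: sub_pgroup (pgroupS sMP pP) => r; rewrite !inE => ->.
- by apply: sub_pgroup qQ => r; rewrite !inE orbC => ->.
- move=> g Gg; apply: (permM q (Q :^ g)%G q_pr q'p).
  by rewrite pHallJ.
move=> A [sMA sAG pqA nAN]; set N := <<_>> in nAN.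
have nsNG : N <| G.
  by rewrite /normal gen_subG class_support_subG // norms_gen // class_support_norm.
have sQN : Q \subset N by rewrite sub_gen ?sub_class_support.
pose L := (A :&: N :&: 'C_G(R))%G.
have nsCG : 'C_G(R) <| G by rewrite /normal subsetIl normsI ?normG ?norms_cent.
have nsLN : L <| N.
  rewrite /normal /= subIset ?subsetIr //=.
  apply: normsI (subset_trans (normal_sub nsNG) (normal_norm nsCG)).
  by rewrite normsI ?normG.
have sLR : L \subset R.
  rewrite -defF; apply: (solvable_cent_Fitting nsNG nsLN); last first.
    by rewrite defF /= setIA subsetIr.
  apply: solvableS (_ : L \subset A) _; first by rewrite /= -setIA subsetIl.
  apply: Burnside_p_a_q_b.
  have /= := uniq_leq_size (primes_uniq #|A|) (s2 := [:: p; q]); apply.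
  move=> r; rewrite mem_primes => /and3P[r_pr _ rA].
  have := pnatPpi pqA (_ : r \in \pi(A)).
  by rewrite !inE mem_primes r_pr rA cardG_gt0; apply.
(* [M] lies in [A] and in ['C_G(R)], and [Q] in [N]. As [N] normalises [A], while [N] and ['C_G(R)]
   are normal in [G], all three contain the commutators. *)
have sMQR : [~: M, Q] \subset R.
  apply: subset_trans sLR; rewrite /= !subsetI.
  rewrite (subset_trans (commgSS sMA sQN)) ?commg_subl //=.
  rewrite (subset_trans (commgSS sMG sQN)) ?commg_subr ?normal_norm //=.
  have sMC : M \subset 'C_G(R) by rewrite subsetI sMG (subset_trans sMP).
  rewrite -subsetI (subset_trans (commgSS sMC sQG)) // commg_subl.
  by case/andP: nsCG.
apply/subsetP=> x Qx; rewrite inE conjYg join_subG.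
rewrite (normsP nRG) ?(subsetP sQG) // joing_subr andbT.
apply/subsetP=> _ /imsetP[m Mm ->]; rewrite -(mulKVg m (m ^ x)) -commgEl.
apply: groupM; first exact: subsetP (joing_subl _ _) _ Mm.
apply: subsetP (joing_subr _ _) _ _; apply: (subsetP sMQR).
exact: mem_commg.
Qed.

End SylowPermuting.

(** * Passage to quotients and back *)

Section Lifting.
Variable gT : finGroupType.
Implicit Types (G K P M N : {group gT}) (p : nat).

Lemma quotient_permuting p G K M :
    K <| G -> M \subset G -> Sylow_p'_permuting p G M ->
  Sylow_p'_permuting p (G / K)%G (M / K)%G.
Proof.
move=> nsKG sMG permM q Qb q_pr q'p sylQb; have nKG := normal_norm nsKG.
have [Q sylQ] := Sylow_exists q G; have sQG := pHall_sub sylQ.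
have [_ /morphimP[g Ng Gg ->] ->] :=
  Sylow_trans (quotient_pHall (subset_trans sQG nKG) sylQ) sylQb.
have sylQg : q.-Sylow(G) (Q :^ g)%G by rewrite pHallJ.
rewrite /= -quotientJ // /commute -quotientMl ?(subset_trans sMG) //.
rewrite -quotientMl ?(subset_trans (pHall_sub sylQg)) //.
by congr (_ / K); apply: permM sylQg.
Qed.

(** The hypothesis on [K] puts [P :&: K] inside each maximal [M], so [M / K] stays maximal and
    membership in it lifts to [M]. *)
Lemma quotient_Phi_from_permuting p G P K :
    prime p -> p.-Sylow(G) P -> K <| G -> P :&: K \subset 'Phi(P) ->
  Phi_from_permuting p G P -> Phi_from_permuting p (G / K)%G (P / K)%G.
Proof.
move=> p_pr sylP nsKG sPKPhi PhiP xb; have [sPG pP _] := and3P sylP.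
have nKP := subset_trans sPG (normal_norm nsKG).
case/morphimP=> x Nx Px -> permMx /=.
rewrite -(quotient_Phi pP nKP) mem_quotient //; apply: PhiP => // M maxM permM.
have sMP := proper_sub (maxgroupp maxM).
have sPKM : P :&: K \subset M := subset_trans sPKPhi (Phi_sub_max maxM).
have maxMK : maximal (M / K) (P / K).
  apply: p_index_maximal; first exact: quotientS.
  by rewrite index_quotient_eq // (p_maximal_index pP maxM).
have := permMx _ maxMK (quotient_permuting nsKG (subset_trans sMP sPG) permM).
case/morphimP=> y Ny My /rcoset_kercosetP.
move/(_ Nx Ny)/rcosetP=> [k Kk def_x].
rewrite def_x groupMr // (subsetP sPKM) // inE Kk andbT.
by rewrite -(groupMr _ (subsetP sMP y My)) -def_x.
Qed.

Lemma quotient_normal_mul G K P :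
   K <| G -> P / K <| G / K -> P \subset 'N(K) -> K <*> P <| G.
Proof.
move=> nsKG nsPK nKP; rewrite -(quotientGK nsKG) norm_joinEr // -quotientK //.
by rewrite cosetpre_normal.
Qed.

(* Frattini argument: a p-complement Q of the preimage of 'O_p^'(G / N) has all
   its conjugates under N, so P = N * 'N_P(Q), whence P normalises Q. *)
Lemma normal_Sylow_lift p G P N :
    p.-Sylow(G) P -> N <| G -> N \subset 'Phi(P) -> 'O_p^'(G) = 1 ->
  'O_p^'(G / N) <*> (P / N) <| G / N -> P <| G.
Proof.
move=> sylP nsNG sNPhi p'G1 nsKP; have [sPG pP _] := and3P sylP.
have sNP := subset_trans sNPhi (Phi_sub P); have nNG := normal_norm nsNG.
have [K defK sNK nsKG] := inv_quotientN nsNG (pcore_normal p^' (G / N)).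
have [sKG nKG] := andP nsKG.
have pN := pgroupS sNP pP; have nsNK := normalS sNK sKG nsNG.
have p'KN : p^'.-group (K / N) by rewrite -defK pcore_pgroup.
have hallN : p.-Hall(K) N.
  rewrite /pHall sNK pN -card_quotient ?(subset_trans sKG) //.
have [Q /complP[tiNQ defNQ]] := splitsP (SchurZassenhaus_split (pHall_Hall hallN) nsNK).
have sQK : Q \subset K by rewrite -defNQ mulG_subr.
have p'Q : p^'.-group Q.
  rewrite (isog_pgroup _ (quotient_isog _ tiNQ)) ?(pgroupS _ p'KN) ?quotientS //.
  exact: subset_trans sQK (normal_norm nsNK).
have coNQ : coprime #|N| #|Q| := pnat_coprime pN p'Q.
have nNQ : Q \subset 'N(N) by rewrite (subset_trans sQK) ?normal_norm.
have sGNN : G \subset 'N(Q) * N.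
  apply/subsetP=> g Gg.
  have [] := @SchurZassenhaus_trans_sol _ N Q (Q :^ g)%G (pgroup_sol pN) nNQ.
  - by rewrite defNQ -(normsP nKG g Gg) conjSg.
  - exact: coNQ.
  - by rewrite cardJg.
  move=> n Nn /= defQg; rewrite -(mulgKV n g) mem_mulg // inE conjsgM defQg.
  by rewrite -conjsgM mulgV conjsg1.
have nQP : P \subset 'N(Q).
  have: 'Phi(P) <*> 'N_P(Q) = P.
    apply/eqP; rewrite eqEsubset join_subG Phi_sub subsetIl /=.
    apply/subsetP=> x Px.
    have /mulsgP[h n NQh Nn def_x] := subsetP sGNN x (subsetP sPG x Px).
    rewrite def_x groupM // ?(subsetP (joing_subl _ _) n) ?(subsetP sNPhi) //.
    apply: (subsetP (joing_subr _ _)); rewrite inE NQh andbT.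
    by rewrite -(groupMr _ (subsetP sNP n Nn)) -def_x.
  by move/Phi_nongen; rewrite genGid => <-; apply: subsetIr.
(* [N] lies in [P], so both factors of ['N(Q) * N] normalise [Q]; as a normal [p']-subgroup, [Q] is
   then trivial. *)
have nQG : G \subset 'N(Q).
  rewrite (subset_trans sGNN) // mul_subG //; exact: subset_trans sNP nQP.
have Q1 : Q :=: 1.
  apply/trivgP; rewrite -p'G1 pcore_max // /normal nQG andbT.
  exact: subset_trans sKG.
have KN : K / N = 1 by rewrite -defNQ Q1 mulg1 trivg_quotient.
have nsPN : P / N <| G / N by move: nsKP; rewrite defK KN joing1G.
have := quotient_normal_mul nsNG nsPN (subset_trans sPG nNG).
by rewrite (joing_idPr sNP).
Qed.

(** Let [C] be the centraliser of ['Phi(P)] in [G]. Transfer makes [P] meet the derived subgroup of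
    [C] trivially; this is then a normal [p']-subgroup, so it is trivial, and [P] is characteristic
    in the abelian [C]. *)
Lemma abelian_Sylow_normal p G P :
    p.-Sylow(G) P -> abelian P -> maximal 'Phi(P) P -> 'Phi(P) <| G -> 'Phi(P) != 1 ->
  'O_p^'(G) = 1 -> P <| G.
Proof.
move=> sylP abP maxM nsMG ntM p'G1; have [sPG pP _] := and3P sylP.
set M := 'Phi(P) in maxM nsMG ntM.
have nsCG : 'C_G(M) <| G.
  by rewrite /normal subsetIl normsI ?normG ?norms_cent ?normal_norm.
have sPC : P \subset 'C_G(M).
  by rewrite subsetI sPG (subset_trans abP) ?centS ?Phi_sub.
have sylPC : p.-Sylow('C_G(M)) P := pHall_subl sPC (subsetIl _ _) sylP.
have TI := abelian_Hall_der1_center_TI abP (pHall_Hall sylPC).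
set C := 'C_G(M)%G in nsCG sPC sylPC TI *.
have sMZ : M \subset P :&: 'Z(C).
  rewrite subsetI Phi_sub /= subsetI (subset_trans (Phi_sub P) sPC) /=.
  by rewrite centsC subsetIr.
have sPC'M : P :&: C^`(1) \subset M.
  (* Otherwise ['Phi(P)] and this intersection generate [P]; then [P], and with it ['Phi(P)], lies
     in the derived subgroup of [C], so [TI] makes ['Phi(P)] trivial. *)
  apply: contraR ntM => nsPC'M; rewrite -subG1 -TI subsetI sMZ.
  have := mulg_normal_maximal (Phi_normal P) maxM (subsetIl P C^`(1)) nsPC'M.
  rewrite -norm_joinEr ?subIset ?gFnorm // => /Phi_nongen; rewrite genGid => defP.
  by rewrite (subset_trans (Phi_sub P)) // -defP subsetIr.
have PC'1 : P :&: C^`(1) = 1.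
  by apply/trivgP; rewrite -TI subsetI (subset_trans sPC'M) //= subsetIr.
have C'1 : C^`(1) = 1.
  apply/trivgP; rewrite -p'G1 pcore_max ?gFnormal_trans //.
  have /and3P[_ _] := Sylow_setI_normal (der_normal 1 C) sylPC.
  by rewrite [X in #|_ : X|](setIC C^`(1)) PC'1 indexg1.
have abC : abelian C by apply/derG1P.
have nsPC : P <| C by rewrite /normal sPC (subset_trans _ (sub_abelian_norm abC _)).
apply: (char_normal_trans _ nsCG).
by rewrite -(normal_Hall_pcore sylPC nsPC) pcore_char.
Qed.
End Lifting.

(** If ['O_p(G)] is proper in [P], it equals every permuting maximal subgroup; so it lies in
    ['Phi(P)] and is trivial. *)
Lemma normal_Sylow_of_Phi_TI (gT : finGroupType) (p : nat) (G P : {group gT}) :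
    prime p -> p.-Sylow(G) P -> Phi_from_permuting p G P -> #|P| != p ->
    'O_p^'(G) = 1 -> 'O_p(G) :&: 'Phi(P) = 1 ->
  P <| G.
Proof.
move=> p_pr sylP PhiP oP p'G1 tiRPhi; have [sPG pP _] := and3P sylP.
have sRP : 'O_p(G) \subset P := pcore_sub_Hall sylP.
have cPR : P \subset 'C('O_p(G)).
  apply/commG1P/trivgP; rewrite -tiRPhi subsetI commg_subr.
  rewrite (subset_trans sPG) ?gFnorm //= (Phi_joing pP).
  apply: subset_trans (joing_subl _ _); exact: commgS sRP.
have [defR | neRP] := eqVneq 'O_p(G) P; first by rewrite -defR pcore_normal.
have permM (M : {group gT}) : maximal M P -> Sylow_p'_permuting p G M -> M :=: 'O_p(G).
  move=> maxM permM; have [prM maxM'] := maxgroupP maxM.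
  have sMR := permuting_sub_pcore p_pr sylP (p_maximal_normal pP maxM) permM p'G1 cPR.
  by apply/esym/maxM'; rewrite // properEneq neRP.
have R1 : 'O_p(G) = 1.
  apply/trivgP; rewrite -tiRPhi subsetI subxx; apply/subsetP=> x Rx.
  by apply: PhiP => [|M maxM /(permM M maxM) ->]; rewrite ?(subsetP sRP).
(* A permuting [M] would be trivial and of index [p], against [oP]; so there is none, and [PhiP]
   applies vacuously. *)
have PPhi : P \subset 'Phi(P).
  apply/subsetP=> x Px; apply: PhiP => // M maxM /(permM M maxM) M1.
  by case/eqP: oP; rewrite -(p_maximal_index pP maxM) M1 R1 indexg1.
have -> : P :=: 1.
  by apply/eqP/negPn/negP=> /Phi_proper; rewrite properE PPhi andbF.
exact: normal1.
Qed.

Lemma pcore_Sylow_normal (gT : finGroupType) (p : nat) (G P : {group gT}) :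
    prime p -> p.-Sylow(G) P -> Phi_from_permuting p G P -> #|P| != p ->
  'O_p^'(G) <*> P <| G.
Proof.
move=> p_pr; have [n leGn] := ubnP #|G|.
elim: n => // n IHn in gT G P leGn * => sylP PhiP oP.
have [sPG pP _] := and3P sylP.
have IHq (N : {group gT}) :
    N <| G -> N :!=: 1 -> P :&: N \subset 'Phi(P) -> #|P / N| != p ->
    'O_p^'(G / N) <*> (P / N) <| G / N.
  move=> nsNG ntN sPN oPN; apply: IHn => //.
  - by rewrite (leq_trans (ltn_quotient ntN (normal_sub nsNG))).
  - by rewrite quotient_pHall ?(subset_trans sPG) ?normal_norm.
  exact: quotient_Phi_from_permuting.
have [p'G1 | ntp'G] := eqVneq 'O_p^'(G) 1; last first.
  have tiPp' : P :&: 'O_p^'(G) = 1.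
    by rewrite coprime_TIg // (pnat_coprime pP (pcore_pgroup _ _)).
  have nKP := subset_trans sPG (gFnorm _ _) : P \subset 'N('O_p^'(G)).
  apply: quotient_normal_mul; rewrite ?pcore_normal //.
  have := IHq 'O_p^'(G)%G (pcore_normal _ _) ntp'G.
  rewrite /= tiPp' sub1G trivg_pcore_quotient joing1G; apply=> //.
  by rewrite -(card_isog (quotient_isog nKP _)) // setIC.
rewrite p'G1 joing1G.
have [tiR | ntR] := eqVneq ('O_p(G) :&: 'Phi(P)) 1.
  exact: normal_Sylow_of_Phi_TI tiR.
pose N := ('O_p(G) :&: 'Phi(P))%G.
have sNP : N \subset P by rewrite subIset ?Phi_sub ?orbT.
(* By [PhiP], [N] consists of the elements of ['O_p(G)] lying in every permuting [M], and each
   ['O_p(G) :&: M] is normal in [G]. *)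
have nsNG : N <| G.
  apply/andP; split; first by rewrite subIset ?pcore_sub.
  apply/subsetP=> g Gg; rewrite inE; apply/subsetP=> _ /imsetP[x /setIP[Rx Phix] ->].
  have nsRG := pcore_normal p G.
  have Rxg : x ^ g \in 'O_p(G) by rewrite memJ_norm ?(subsetP (normal_norm nsRG)).
  rewrite inE Rxg; apply: PhiP => [|M maxM permM].
    exact: subsetP (pcore_sub_Hall sylP) _ Rxg.
  have nsRM := normal_setI_permuting sylP (p_maximal_normal pP maxM) permM
    nsRG (pcore_pgroup p G).
  have : x \in 'O_p(G) :&: M by rewrite inE Rx (subsetP (Phi_sub_max maxM)).
  rewrite -(memJ_norm _ (subsetP (normal_norm nsRM) g Gg)).
  by case/setIP.
(* The induction hypothesis excludes [P / N] of order [p]; but then [N] is maximal in [P], so it is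
   ['Phi(P)] and [P] is cyclic. *)
have [oPN | oPN] := eqVneq #|P / N| p; last first.
  apply: (normal_Sylow_lift sylP nsNG) => //; first exact: subsetIr.
  apply: IHq => //; exact: subset_trans (subsetIr _ _) (subsetIr _ _).
have nNP := subset_trans sPG (normal_norm nsNG).
have maxN : maximal N P.
  by apply: p_index_maximal; rewrite // -card_quotient // oPN.
have defPhi : 'Phi(P) = N.
  by apply/eqP; rewrite eqEsubset Phi_sub_max //= subsetIr.
apply: (abelian_Sylow_normal sylP); rewrite ?defPhi //.
by apply/cyclic_abelian/Phi_quotient_cyclic; rewrite defPhi prime_cyclic // oPN.
Qed.

(** * Groups with a normal Sylow subgroup *)

(** ['C(Y)] is the kernel of conjugation on [Y], and [Aut Y] is abelian of order [p.-1]. *)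
Lemma prime_normal_cent (gT : finGroupType) (p : nat) (G Y : {group gT}) :
    prime p -> Y <| G -> #|Y| = p ->
  G^`(1) \subset 'C(Y) /\ {in G, forall g, g ^+ p.-1 \in 'C(Y)}.
Proof.
move=> p_pr /andP[sYG nYG] oY.
have cycY : cyclic Y by rewrite prime_cyclic ?oY.
split=> [|g Gg].
  rewrite -ker_conj_aut gen_subG; apply/subsetP=> _ /imset2P[g h Gg Gh ->].
  apply/kerP; first by rewrite groupR ?(subsetP nYG).
  rewrite morphR ?(subsetP nYG) //; apply/eqP/commgP.
  by apply: (centsP (Aut_cyclic_abelian cycY)); apply: Aut_aut.
rewrite -ker_conj_aut; apply/kerP; first by rewrite groupX ?(subsetP nYG).
rewrite morphX ?(subsetP nYG) //; apply/eqP.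
by rewrite -order_dvdn -totient_prime // -oY -card_Aut_cyclic // order_dvdG ?Aut_aut.
Qed.

Section NormalSylow.
Variable gT : finGroupType.
Implicit Types (G P M : {group gT}) (p : nat).

(** A complement of [C :&: P] in [C] centralises [P], so it is normal in [C] and lies in
    ['O_p^'(C)], which is trivial along with ['O_p^'(G)]. *)
Lemma cent_normal_Sylow_sub p G P :
  p.-Sylow(G) P -> P <| G -> 'O_p^'(G) = 1 -> 'C_G(P) \subset P.
Proof.
move=> sylP nsPG p'G1; have [sPG pP _] := and3P sylP; set C := 'C_G(P)%G.
have nsCG : C <| G by rewrite /normal subsetIl normsI ?normG ?norms_cent ?normal_norm.
have sylPC := Sylow_setI_normal nsCG sylP.
have nsPC : C :&: P <| C by apply: normalGI nsPG; apply: normal_sub.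
have [Q /complP[tiQ defC]] := splitsP (SchurZassenhaus_split (pHall_Hall sylPC) nsPC).
have sQC : Q \subset C by rewrite -defC mulG_subr.
have nQC : C \subset 'N(Q).
  rewrite -defC mul_subG ?normG // cents_norm // centsC.
  apply: subset_trans (subset_trans sQC _) _; first exact: subsetIr.
  by rewrite centS ?subsetIr.
have p'Q : p^'.-group Q.
  have /and3P[_ _] := sylPC.
  rewrite -divgS ?subsetIl // -{1}defC TI_cardMg // mulKn //.
have sQ1 : Q \subset [1].
  rewrite -p'G1; apply: subset_trans (pcore_max p'Q (_ : Q <| C)) _; first exact/andP.
  by rewrite pcore_max ?pcore_pgroup // gFnormal_trans.
have: C \subset P by rewrite -defC mul_subG ?subsetIr // (subset_trans sQ1) ?sub1G.
by [].
Qed.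

(** The [p']-part of [c] acts trivially on [P / 'Phi(P)]; the action being coprime, it centralises
    [P], so it lies in [P] and is trivial. *)
Lemma mem_normal_Sylow p G P c :
    prime p -> p.-Sylow(G) P -> P <| G -> 'O_p^'(G) = 1 -> c \in G ->
    [~: P, <[c]>] \subset 'Phi(P) -> c \in P.
Proof.
move=> p_pr sylP nsPG p'G1 Gc sPcPhi; have [sPG pP _] := and3P sylP.
pose A := <[c.`_p^']>%G; have sAc : A \subset <[c]> by rewrite cycle_subG mem_cycle.
have sAG : A \subset G by rewrite (subset_trans sAc) ?cycle_subG.
have p'A : p^'.-group A by apply: p_elt_constt.
have nPA := subset_trans sAG (normal_norm nsPG).
have nPhiA : A \subset 'N('Phi(P)) by rewrite gFnorm_trans.
have nPhiP : P \subset 'N('Phi(P)) := normal_norm (Phi_normal P).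
have coPA : coprime #|P| #|A| := pnat_coprime pP p'A.
have cPA : A \subset 'C(P).
  have := coprime_quotient_cent (Phi_sub P) nPhiA coPA (pgroup_sol pP).
  rewrite [RHS](setIidPl _); last first.
    by apply: quotient_cents2r; apply: subset_trans (commgS _ sAc) sPcPhi.
  move=> defP; rewrite centsC; apply/setIidPl.
  have: 'Phi(P) <*> 'C_P(A) = P.
    rewrite norm_joinEr ?subIset ?nPhiP // -quotientK ?subIset ?nPhiP //.
    by rewrite defP quotientGK ?Phi_normal.
  by move/Phi_nongen; rewrite genGid.
have sAP : A \subset P.
  by rewrite (subset_trans _ (cent_normal_Sylow_sub sylP nsPG p'G1)) // subsetI sAG.
rewrite (mem_normal_Hall sylP nsPG Gc) -(consttC p c).
have -> : c.`_p^' = 1.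
  apply/set1gP; rewrite -[[1]](coprime_TIg coPA) inE cycle_id andbT.
  by rewrite -cycle_subG.
by rewrite mulg1 p_elt_constt.
Qed.

Lemma der1_exponent_sub_normal_Sylow p G P :
    prime p -> p.-Sylow(G) P -> P <| G -> 'O_p^'(G) = 1 ->
    (forall x, x \in P ->
      (forall M, maximal M P -> M <| G -> x \in M) -> x \in 'Phi(P)) ->
  G^`(1) \subset P /\ {in G, forall g, g ^+ p.-1 \in P}.
Proof.
move=> p_pr sylP nsPG p'G1 PhiP; have [sPG pP _] := and3P sylP.
(* If [c] centralises every such [P / M], then [[~: P, <[c]>]] lies in every such [M], hence in
   ['Phi(P)]. *)
have memP c : c \in G ->
    (forall M, maximal M P -> M <| G -> coset M c \in 'C(P / M)) -> c \in P.
  move=> Gc cPMc; apply: (mem_normal_Sylow p_pr sylP nsPG p'G1 Gc).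
  rewrite gen_subG; apply/subsetP=> _ /imset2P[x y Px cy ->].
  have Gy : y \in G by apply: subsetP cy; rewrite cycle_subG.
  apply: PhiP => [|M maxM nsMG].
    by rewrite groupMl ?groupV // memJ_norm // (subsetP (normal_norm nsPG)).
  have nMG := normal_norm nsMG; have nMP := subset_trans sPG nMG.
  have Nx := subsetP nMP x Px; have Ny := subsetP nMG y Gy.
  apply: coset_idr; first by rewrite groupR.
  rewrite morphR //; apply/eqP/commgP.
  have cy' : coset M y \in 'C(P / M).
    have /cycleP[i ->] := cy; rewrite morphX ?(subsetP nMG) // groupX //.
    exact: cPMc.
  by apply/commute_sym; apply: (centP cy'); apply: mem_quotient.
have centPM M : maximal M P -> M <| G ->
    (G / M)^`(1) \subset 'C(P / M) /\
    {in G / M, forall g, g ^+ p.-1 \in 'C(P / M)}.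
  move=> maxM nsMG; apply: prime_normal_cent; rewrite ?quotient_normal //.
  rewrite card_quotient ?(p_maximal_index pP maxM) //.
  exact: subset_trans sPG (normal_norm nsMG).
split=> [|g Gg].
  rewrite gen_subG; apply/subsetP=> _ /imset2P[g h Gg Gh ->].
  apply: memP => [|M maxM nsMG]; first by rewrite groupR.
  have nMG := subsetP (normal_norm nsMG); have [sG'C _] := centPM M maxM nsMG.
  rewrite morphR ?nMG // (subsetP sG'C) // mem_commg ?mem_quotient //.
apply: memP => [|M maxM nsMG]; first by rewrite groupX.
have nMG := subsetP (normal_norm nsMG); have [_ cGX] := centPM M maxM nsMG.
by rewrite morphX ?nMG // cGX ?mem_quotient.
Qed.

End NormalSylow.

Theorem mainTheorem1 (gT : finGroupType) (G P : {group gT}) (p d : nat)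
    (Md : {set {group gT}}) :
  (p \in \pi(G))%g ->
  (p.-Sylow(G) P)%g ->
  d = ('m(P))%g ->
  #|Md| = d ->
  (forall M : {group gT}, M \in Md -> maximal M P) ->
  (\bigcap_(M in Md) (M : {set gT}))%g = ('Phi(P))%g ->
  (forall M : {group gT}, M \in Md -> s_semipermutable G M) ->
  #|P| = p \/ p_supersoluble p G.
Proof.
move=> piGp sylP _ _ maxMd PhiMd permMd; have [sPG pP _] := and3P sylP.
have p_pr : prime p by move: piGp; rewrite mem_primes => /and3P[].
have [oP | oP] := eqVneq #|P| p; [by left | right].
have PhiP : Phi_from_permuting p G P.
  move=> x Px Mx; rewrite -PhiMd; apply/bigcapP=> M MdM.
  apply: Mx (maxMd M MdM) _ => q Q q_pr q'p sylQ.
  have [_ permM] := permMd M MdM.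
  have [piq | pi'q] := boolP (q \in \pi(G)).
    apply: permM sylQ => //.
    have pM := pgroupS (proper_sub (maxgroupp (maxMd M MdM))) pP.
    rewrite coprime_sym; apply: pnat_coprime pM _.
    by rewrite pnatE // !inE.
  have -> : Q :=: 1.
    apply/eqP; rewrite trivg_card1 (card_Hall sylQ) p_part_eq1.
    exact: pi'q.
  exact: commute1.
have nsSG := pcore_Sylow_normal p_pr sylP PhiP oP.
have nsKG := pcore_normal p^' G; set K := 'O_p^'(G)%G in nsSG nsKG.
have nKG := normal_norm nsKG; have nKP := subset_trans sPG nKG.
have p'K : p^'.-group K := pcore_pgroup p^' G.
have sylPK := quotient_pHall nKP sylP.
have tiPK : P :&: K = 1 by apply: coprime_TIg; exact: pnat_coprime pP p'K.
have defPK : (K <*> P) / K = P / K by rewrite quotientYidl.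
have nsPK : P / K <| G / K by rewrite -defPK quotient_normal.
have [||sG'P sGpP] := der1_exponent_sub_normal_Sylow p_pr sylPK nsPK.
- exact: trivg_pcore_quotient.
- have := quotient_Phi_from_permuting p_pr sylP nsKG.
  rewrite tiPK sub1G => /(_ isT PhiP) PhiPK x Px Mx; apply: PhiPK => // M maxM permM.
  (* [M] is its own intersection with the normal [p]-subgroup [P / K], so permuting makes it normal
     in [G / K]. *)
  apply: Mx => //; rewrite -(setIidPr (proper_sub (maxgroupp maxM))).
  apply: normal_setI_permuting sylPK _ permM nsPK _; last exact: quotient_pgroup.
  exact: p_maximal_normal (quotient_pgroup K pP) maxM.
(* Both facts about [G / K] pull back, [K <*> P] being the preimage of [P / K]. *)
apply: (p_supersoluble_criterion sylP nsKG p'K nsSG) => //.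
- rewrite -(quotientSGK _ (joing_subl K P)) ?defPK ?quotient_der //.
  exact: subset_trans (der_sub 1 G) nKG.
move=> g Gg; rewrite -(quotientGK (normalS (joing_subl K P) (normal_sub nsSG) nsKG)).
have Ng := subsetP nKG g Gg.
by rewrite mem_morphpre ?groupX //= defPK morphX // sGpP // mem_quotient.
Qed.
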